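(* For any $c \ge 1$ and any $d \in (0, \frac{n}{3}]$, any one-pass streaming algorithm in the node-arrival model that, with probability of error at most $0.49$, computes a $(c,d)$-approximation of the cost of the optimal correlation clustering of the induced graph on $n$ nodes requires $\Omega(n)$ bits of space.
   Context: Node-arrival stream model: the stream consists of the $n$ objects (nodes); a fixed pairwise similarity function determines for any two nodes whether they are similar ($+1$ edge) or dissimilar ($-1$ edge), and it can be evaluated on nodes stored in memory. The induced graph is the complete graph on the nodes with these $\pm1$ labels. The cost of a clustering (partition of the nodes) is the number of $+1$ edges between different clusters plus the number of $-1$ edges inside clusters; the optimal cost is the minimum over all partitions. An estimate $\tilde X$ is a $(c,d)$-approximation of $X$ if $X \le \tilde X \le cX+d$. A ''$0.49$-error'' algorithm outputs a correct approximation with probability at least $0.51$. *)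

(* Defs.v *)
From HB Require Import structures.
From mathcomp Require Import all_boot all_order all_algebra.
Set Implicit Arguments.
Unset Strict Implicit.
Unset Printing Implicit Defensive.
Import Order.TTheory GRing.Theory Num.Theory.
Local Open Scope nat_scope.

Section CorrelationClustering.
Variable n : nat.

(* A complete graph with +1/-1 edges on the nodes 'I_n is given by the relation
   [g] of its +1 edges; an edge {i, j} is represented by the pair with i < j,
   so only the values of [g] at such pairs matter. *)
Implicit Types (g : rel 'I_n) (P : {set {set 'I_n}}).

Definition same_cluster P : rel 'I_n :=
  fun i j => [exists B in P, (i \in B) && (j \in B)].

Definition clustering_cost g P : nat :=
  #|[set e : 'I_n * 'I_n | [&& e.1 < e.2, g e.1 e.2 & ~~ same_cluster P e.1 e.2]]|
  + #|[set e : 'I_n * 'I_n | [&& e.1 < e.2, ~~ g e.1 e.2 & same_cluster P e.1 e.2]]|.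

Definition singletons : {set {set 'I_n}} := [set [set i] | i : 'I_n].

(* [arg min] needs a default clustering, see [opt_cost_min] *)
Definition opt_cost g : nat :=
  clustering_cost g
    [arg min_(P < singletons | partition P [set: 'I_n]) clustering_cost g P].

Lemma singletons_partition : partition singletons [set: 'I_n].
Proof.
apply/and3P; split.
- apply/eqP/setP => i; rewrite inE; apply/bigcupP; exists [set i]; last by rewrite inE.
  by apply/imsetP; exists i.
- apply/trivIsetP => _ _ /imsetP[i _ ->] /imsetP[j _ ->] ij.
  by rewrite disjoints1 inE; apply: contraNneq ij => ->.
- by apply/imsetP => -[i _ /setP/(_ i)]; rewrite !inE eqxx.
Qed.

Lemma opt_cost_min g :
  (exists2 P, partition P [set: 'I_n] & opt_cost g = clustering_cost g P) /\
  (forall P, partition P [set: 'I_n] -> opt_cost g <= clustering_cost g P).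
Proof.
rewrite /opt_cost; case: arg_minnP => [|P partP minP].
  exact: singletons_partition.
by split; [exists P | exact: minP].
Qed.

End CorrelationClustering.

Definition induced_graph (U : eqType) (sim : rel U) n (s : n.-tuple U) : rel 'I_n :=
  fun i j => sim (tnth s i) (tnth s j).

From mathcomp Require Import all_classical all_reals all_analysis.
Local Open Scope classical_set_scope.
Local Open Scope ring_scope.

(* One-pass algorithms with [b] bits of memory over streams of objects of [U].
   Space is the number of bits kept between two arrivals. The program, the
   random seed (an arbitrary probability space, which may hold fresh coins for
   each arrival as well as coins reused later) and the number of nodes seen so
   far are not charged. *)
Record streaming_algorithm (R : realType) (U : Type) (b : nat) := StreamingAlgorithm {
  seed_display : measure_display;
  seed : measurableType seed_display;
  seed_law : probability seed R;
  init : seed -> b.-tuple bool;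
  step : seed -> nat -> b.-tuple bool -> U -> b.-tuple bool;
  output : seed -> b.-tuple bool -> R;
  measurable_init : forall m, measurable [set w | init w = m];
  measurable_step : forall t m v m', measurable [set w | step w t m v = m'];
  measurable_output : forall m, measurable_fun setT (fun w => output w m)
}.

Section Run.
Variables (R : realType) (U : Type) (b : nat) (A : streaming_algorithm R U b).

Fixpoint run_from (w : seed A) (t : nat) (m : b.-tuple bool) (s : seq U) : b.-tuple bool :=
  if s is v :: s' then run_from w t.+1 (step w t m v) s' else m.

Definition run (w : seed A) (s : seq U) : R := output w (run_from w 0 (init w) s).

End Run.

Definition is_approximation (R : realType) (c d X est : R) : Prop :=
  X <= est <= c * X + d.

(* error probability at most 0.49 on every stream of [n] distinct objects *)
Definition approximates_opt_cost (R : realType) (U : eqType) (sim : rel U) (n : nat)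
    (c d : R) (b : nat) (A : streaming_algorithm R U b) : Prop :=
  forall s : n.-tuple U, uniq s ->
    ((51%:R / 100%:R)%:E <=
     seed_law A [set w | is_approximation c d
                           (opt_cost (induced_graph sim s))%:R (run w s)])%E.

(* Main.v *)
Require Import Defs.
From mathcomp Require Import all_boot all_order all_algebra.
From mathcomp Require Import all_classical all_reals all_analysis.
From mathcomp Require Import measurable_realfun ring lra zify.
Import Order.TTheory GRing.Theory Num.Theory.
Local Open Scope ring_scope.

(** Reduction from the one-way communication problem INDEX. Alice holds k bits
  and streams one node per bit, naming the bit and its value; Bob, who wants
  bit i, streams m further nodes labelled by i. The only +1 edges join the node
  "bit i is true" to Bob's nodes for i, so the induced graph is a star with m
  leaves, of optimal cost at least m - 1 > n/3 >= d, if bit i is true, and has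
  no +1 edge, hence cost 0, otherwise. Comparing a (c, d)-approximation with d
  thus reveals bit i, for every c. The memory after Alice's part is a b-bit
  message from which each bit is recovered with probability at least 0.51; for
  uniform bits this forces b = Omega(k): each of the 2^b decoders has an
  exponentially small probability of guessing a 0.51 fraction of the bits. *)

(** * Optimal cost of stars and edgeless graphs *)

Lemma same_cluster_euclid {n} {P : {set {set 'I_n}}} :
  finset.trivIset P -> forall a i j,
    same_cluster P a i -> same_cluster P a j -> same_cluster P i j.
Proof.
move=> /finset.trivIsetP trivP a i j.
move=> /existsP[B /and3P[PB aB iB]] /existsP[C /and3P[PC aC jC]].
have [EBC|/(trivP _ _ PB PC)/disjointFr/(_ aB)] := eqVneq B C; last by rewrite aC.
by apply/existsP; exists B; rewrite PB iB EBC jC.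
Qed.

(* A cluster containing the centre and q >= 1 leaves saves q edges, but pays at
   least the q - 1 pairs formed by its smallest leaf and the other ones. *)
Lemma star_cost_ge {n} (g : rel 'I_n) (a : 'I_n) (L : {set 'I_n}) :
  {in L, forall l : 'I_n, (a < l)%N && g a l} ->
  {in L &, forall l l' : 'I_n, (l < l')%N -> ~~ g l l'} ->
  (#|L|.-1 <= opt_cost g)%N.
Proof.
move=> ga gL; have [[P partP ->] _] := opt_cost_min g.
have /and3P[_ trivP _] := partP.
pose S := [set l in L | same_cluster P a l].
have leafs : (#|L :\: S| <= #|[set e : 'I_n * 'I_n |
    [&& (e.1 < e.2)%N, g e.1 e.2 & ~~ same_cluster P e.1 e.2]]|)%N.
  rewrite -(card_imset (mem (L :\: S)) (f := pair a)); last by move=> ? ? [].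
  apply/subset_leq_card/fintype.subsetP => _ /imsetP[l + ->].
  by rewrite !inE /= => /andP[+ lL]; rewrite lL /= => ->; rewrite andbA andbT ga.
have pairs : (#|S|.-1 <= #|[set e : 'I_n * 'I_n |
    [&& (e.1 < e.2)%N, ~~ g e.1 e.2 & same_cluster P e.1 e.2]]|)%N.
  have [->|[l0 l0S]] := set_0Vmem S; first by rewrite cards0.
  (* Minimality gives [l1 < l] for every other leaf of [S], so each pair [(l1, l)] has the
     orientation that the cost counts. *)
  have [l1] := arg_minnP (fun l : 'I_n => l : nat) l0S; rewrite -/(l1 \in S) => l1S l1min.
  rewrite (cardsD1 l1) l1S add1n /=.
  rewrite -(card_imset (mem (S :\ l1)) (f := pair l1)); last by move=> ? ? [].
  apply/subset_leq_card/fintype.subsetP => _ /imsetP[l + ->]; rewrite 2!inE => /andP[ll1 lS].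
  have lt_l1l : (l1 < l)%N by rewrite ltn_neqAle eq_sym ll1 l1min.
  move: l1S lS; rewrite !inE /= => /andP[l1L al1] /andP[lL al].
  by rewrite lt_l1l gL //=; apply: (same_cluster_euclid trivP a).
have : (#|L :&: S| + #|L :\: S| = #|L|)%N by rewrite cardsID.
have -> : L :&: S = S by apply/setP => l; rewrite !inE; case: (l \in L).
rewrite /clustering_cost; lia.
Qed.

(** The all-singletons clustering cuts no +1 edge and has no pair inside a cluster. *)
Lemma opt_cost_edgeless {n} (g : rel 'I_n) :
  (forall i j : 'I_n, (i < j)%N -> ~~ g i j) -> opt_cost g = 0%N.
Proof.
move=> g0; apply/eqP; rewrite -leqn0.
apply: leq_trans ((opt_cost_min g).2 _ (singletons_partition n)) _.
rewrite /clustering_cost leqn0 addn_eq0 !cards_eq0; apply/andP; split.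
  apply/eqP/setP => -[i j]; rewrite !inE /=; apply/negP => /and3P[ij gij _].
  by move: (g0 _ _ ij); rewrite gij.
apply/eqP/setP => -[i j]; rewrite !inE /=; apply/negP => /and3P[ij _].
move=> /existsP[_ /and3P[/imsetP[k _ ->]]]; rewrite !inE => /eqP ik /eqP jk.
by move: ij; rewrite ik jk ltnn.
Qed.

(** * Counting bound for randomized INDEX *)

(** Linearity of expectation: the sum is the integral of the number of events that occur at [w]. *)
Lemma sum_probability_le {d} {T : measurableType d} {R : realType}
    (P : probability T R) {I : finType} (E : I -> set T) (C : R) :
  (forall i, measurable (E i)) ->
  (forall w, \sum_i \1_(E i) w <= C) -> (\sum_i P (E i) <= C%:E)%E.
Proof.
move=> mE EC.
have -> : (\sum_i P (E i) = \int[P]_w (\sum_i (\1_(E i) w)%:E))%E.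
  rewrite ge0_integral_sum //.
  - by apply: eq_bigr => i _; rewrite integral_indic // setIT.
  - move=> i; apply: measurableT_comp => //.
have -> : C%:E = (\int[P]_w (cst C%:E w))%E.
  rewrite integral_cst; last by [].
  by rewrite -[LHS]mule1; congr (_ * _)%E; rewrite -(probability_setT P).
apply: ge0_le_integral => //.
- by move=> w _; apply: sume_ge0 => i _.
- by apply: emeasurable_fun_sum => i; apply: measurableT_comp => //.
- by move=> w _; rewrite sumEFin lee_fin.
Qed.

(* From [1 + h <= exp h], summed over all inputs [x] and bounded by the sum over
   all messages; for a fixed message the sum of the exponentials factors over
   the coordinates. *)
Lemma index_guesses_le {R : realType} {I T : finType} (p t : R)
    (M : {ffun I -> bool} -> T) (D : T -> I -> bool) :
  t * \sum_(x : {ffun I -> bool}) \sum_i ((D (M x) i == x i)%:R - p) <=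
  #|T|%:R * (expR (t * (1 - p)) + expR (- t * p)) ^+ #|I| - 2 ^+ #|I|.
Proof.
pose h m (x : {ffun I -> bool}) := t * \sum_i ((D m i == x i)%:R - p).
have card_x : \sum_(x : {ffun I -> bool}) 1 = 2 ^+ #|I| :> R.
  by rewrite sumr_const card_ffun card_bool natrX.
rewrite mulr_sumr lerBrDl -card_x -big_split /=.
apply: (@le_trans _ _ (\sum_x \sum_m expR (h m x))).
  apply: ler_sum => x _; apply: (le_trans (expR_ge1Dx _)).
  rewrite (bigD1 (M x)) //= lerDl; apply: sumr_ge0 => m _; exact: expR_ge0.
rewrite exchange_big /= -sumr_const mulr_suml; apply: ler_sum => m _.
rewrite mul1r le_eqVlt; apply/orP; left; apply/eqP.
transitivity (\prod_i \sum_(v : bool) expR (t * ((D m i == v)%:R - p))).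
  rewrite bigA_distr_bigA; apply: eq_bigr => x _.
  by rewrite /h mulr_sumr expR_sum.
rewrite -prodr_const; apply: eq_bigr => i _.
by rewrite big_bool; case: (D m i) => /=; rewrite sub0r mulrN -mulNr // addrC.
Qed.

(** From [1 - a <= expR (- a)] follows [expR a <= 1 / (1 - a)]. With [t] in place of [1 / 50], the
    two bounds add up to about [2 - t / 50 + t ^ 2 / 2], which is least at [t = 1 / 50]. *)
Lemma biased_bit_factor (R : realType) :
  expR (1 / 50 * (1 - 51 / 100)) + expR (- (1 / 50) * (51 / 100)) <=
  2 * expR (- (1 / 20000)) :> R.
Proof.
have le_inv (a b : R) : 0 < b -> b^-1 <= expR (- a) -> expR a <= b.
  by move=> b0; rewrite expRN lef_pV2 // posrE ?expR_gt0.
have e1 : expR (1 / 50 * (1 - 51 / 100)) <= 10000 / 9902 :> R.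
  apply: le_inv; first lra.
  by rewrite invf_div; apply: le_trans (expR_ge1Dx _); lra.
have e2 : expR (- (1 / 50) * (51 / 100)) <= 10000 / 10102 :> R.
  apply: le_inv; first lra.
  by rewrite invf_div; apply: le_trans (expR_ge1Dx _); lra.
have e3 := expR_ge1Dx (- (1 / 20000) : R).
by apply: (le_trans (lerD e1 e2)); lra.
Qed.

(** Alice and Bob share the seed [w]. Fixing it leaves a deterministic protocol, to which
    [index_guesses_le] applies; averaging over [w] keeps the bound. *)
Lemma randomized_index_bound {d} {T : measurableType d} {R : realType}
    (P : probability T R) (k b : nat)
    (M : T -> {ffun 'I_k -> bool} -> b.-tuple bool)
    (D : T -> b.-tuple bool -> 'I_k -> bool)
    (E : {ffun 'I_k -> bool} -> 'I_k -> set T) :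
  (forall x i, measurable (E x i)) ->
  (forall x i w, E x i w -> D w (M w x) i = x i) ->
  (forall x i, ((51%:R / 100%:R)%:E <= P (E x i))%E) ->
  k%:R / 20000 <= b%:R :> R.
Proof.
move=> mE correct PE.
pose t : R := 1 / 50; pose p : R := 51 / 100.
pose g := expR (t * (1 - p)) + expR (- t * p).
pose tot : R := \sum_(x : {ffun 'I_k -> bool}) \sum_(i : 'I_k) p.
(* [index_guesses_le] solved for the number of correctly guessed pairs [(x, i)]. *)
pose C := t^-1 * (2 ^+ b * g ^+ k - 2 ^+ k) + tot.
have t0 : 0 < t by rewrite /t; lra.
have PC : (\sum_(xi : {ffun 'I_k -> bool} * 'I_k) P (E xi.1 xi.2) <= C%:E)%E.
  apply: sum_probability_le => [xi|w]; first exact: mE.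
  have := @index_guesses_le R _ _ p t (M w) (D w).
  rewrite card_tuple card_bool natrX card_ord -/g mulrC -ler_pdivlMr // mulrC => ind.
  rewrite -lerBlDr; apply: le_trans ind; rewrite lerBlDr -big_split /=.
  rewrite -(pair_bigA _ (fun x i => \1_(E x i) w)) /=.
  apply: ler_sum => x _; rewrite -big_split; apply: ler_sum => i _ /=.
  rewrite subrK indicE; have [/set_mem/correct ->|_] := boolP (_ \in _).
    by rewrite eqxx.
  by [].
(* Each pair [(x, i)] contributes at least [p], so the first term of [C] is nonnegative. *)
have : tot <= C.
  rewrite -lee_fin; apply: le_trans PC; rewrite /tot pair_bigA -sumEFin.
  by apply: lee_sum => xi _; exact: PE.
rewrite /C lerDr pmulr_rge0 ?invr_gt0 // subr_ge0 => le2.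
have {}le2 : 2 ^+ k <= 2 ^+ b * (2 * expR (- (1 / 20000))) ^+ k :> R.
  apply: le_trans le2 _; rewrite ler_pM2l ?exprn_gt0 //.
  apply: lerXn2r (biased_bit_factor R).
    by rewrite nnegrE addr_ge0 ?expR_ge0.
  by rewrite nnegrE mulr_ge0 ?expR_ge0.
move: le2; rewrite exprMn mulrCA -[leLHS]mulr1 ler_pM2l ?exprn_gt0 // => le1.
(* Passing to base e puts [b] and [k / 20000] into one exponent. *)
have le_2e : 2 ^+ b <= expR b%:R :> R.
  rewrite -[b%:R]mulr1 expRM_natl; apply: lerXn2r; rewrite ?nnegrE ?expR_ge0 //.
  by apply: le_trans (expR_ge1Dx _); lra.
have : 1 <= expR (b%:R - k%:R / 20000) :> R.
  apply: le_trans le1 _; rewrite expRD.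
  have -> : - (k%:R / 20000) = k%:R * - (1 / 20000) :> R by ring.
  by rewrite expRM_natl ler_pM2r ?exprn_gt0 ?expR_gt0.
by rewrite -expR0 ler_expR subr_ge0.
Qed.

(** * The hard streams *)

(* [inl (j, v)]: Alice's node telling that bit [j] is [v]; [inr (i, l)]: the
   [l]-th of the nodes by which Bob queries bit [i]. *)
Definition index_node k m : finType := ('I_k * bool + 'I_k * 'I_m)%type.

Definition index_edge {k m} (p q : index_node k m) : bool :=
  match p, q with
  | inl (j, v), inr (i, _) | inr (i, _), inl (j, v) => v && (i == j)
  | _, _ => false
  end.

(** Objects outside the image of [f] are similar to none. *)
Definition index_sim {k m} {U : finType} (f : index_node k m -> U) : rel U :=
  fun u v => [exists p, exists q, [&& u == f p, v == f q & index_edge p q]].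

Definition alice_stream {k m} {U : finType} (f : index_node k m -> U)
    (x : {ffun 'I_k -> bool}) : k.-tuple U :=
  [tuple f (inl (j, x j)) | j < k].

Definition bob_stream {k m} {U : finType} (f : index_node k m -> U)
    (i : 'I_k) : m.-tuple U :=
  [tuple f (inr (i, l)) | l < m].

Definition index_stream {k m} {U : finType} (f : index_node k m -> U)
    (x : {ffun 'I_k -> bool}) (i : 'I_k) : (k + m).-tuple U :=
  [tuple of alice_stream f x ++ bob_stream f i].

Section IndexStream.
Context {k m : nat} {U : finType} {f : index_node k m -> U}.
Context (f_inj : injective f) (x : {ffun 'I_k -> bool}) (i : 'I_k).

Lemma index_sim_sym : symmetric (index_sim f).
Proof.
have edge_sym p q : index_edge p q = index_edge q p :> bool.
  by case: p q => [[? ?]|[? ?]] [[? ?]|[? ?]].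
by move=> u v; apply/existsP/existsP => -[p /existsP[q /and3P[up vq pq]]];
  exists q; apply/existsP; exists p; rewrite up vq edge_sym.
Qed.

Lemma index_simE p q : index_sim f (f p) (f q) = index_edge p q.
Proof.
apply/existsP/idP => [[p' /existsP[q' /and3P[/eqP/f_inj-> /eqP/f_inj-> //]]]|pq].
by exists p; apply/existsP; exists q; rewrite !eqxx.
Qed.

Lemma tnth_index_streaml j : tnth (index_stream f x i) (lshift m j) = f (inl (j, x j)).
Proof. by rewrite tnth_lshift tnth_mktuple. Qed.

Lemma tnth_index_streamr l : tnth (index_stream f x i) (rshift k l) = f (inr (i, l)).
Proof. by rewrite tnth_rshift tnth_mktuple. Qed.

Lemma index_stream_uniq : uniq (index_stream f x i).
Proof.
apply/tuple_uniqP => a b.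
by case: (split_ordP a) => a' ->; case: (split_ordP b) => b' ->;
  rewrite ?tnth_index_streaml ?tnth_index_streamr => /f_inj // [->].
Qed.

Let graph := induced_graph (index_sim f) (index_stream f x i).

Lemma opt_cost_index_stream_true : x i -> (m.-1 <= opt_cost graph)%N.
Proof.
move=> xi; have card_leaves : #|@rshift k m @: 'I_m| = m.
  by rewrite card_imset ?card_ord //; exact: rshift_inj.
(* The centre is Alice's node for bit [i]; it precedes Bob's nodes, the leaves. *)
rewrite -[m in m.-1]card_leaves; apply: (star_cost_ge graph (lshift m i)).
  move=> _ /imsetP[l _ ->]; rewrite /= ltn_addr //= /graph /induced_graph.
  by rewrite tnth_index_streaml tnth_index_streamr index_simE /= xi eqxx.
move=> _ _ /imsetP[l _ ->] /imsetP[l' _ ->] _.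
by rewrite /graph /induced_graph !tnth_index_streamr index_simE.
Qed.

Lemma opt_cost_index_stream_false : ~~ x i -> opt_cost graph = 0%N.
Proof.
move=> xi; apply: opt_cost_edgeless => a b _; rewrite /graph /induced_graph.
case: (split_ordP a) => a' ->; case: (split_ordP b) => b' ->;
  rewrite ?tnth_index_streaml ?tnth_index_streamr index_simE //=;
  by apply: contra xi => /andP[+ /eqP->].
Qed.

End IndexStream.

(** * Runs as protocols, and measurability of their events *)

Lemma run_from_cat {R : realType} {U : Type} {b : nat}
    (A : streaming_algorithm R U b) (w : seed A) t mem (s1 s2 : seq U) :
  run_from w t mem (s1 ++ s2) =
  run_from w (t + size s1) (run_from w t mem s1) s2.
Proof.
elim: s1 t mem => [|v s1 IH] t mem /=; first by rewrite addn0.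
by rewrite IH addSnnS.
Qed.

(** Alice's final memory is the message; Bob resumes at time [k], which does not depend on [x]. *)
Lemma run_index_stream {R : realType} {k m b : nat} {U : finType}
    (A : streaming_algorithm R U b) (f : index_node k m -> U) x i (w : seed A) :
  run w (index_stream f x i) =
  output w (run_from w k (run_from w 0 (init w) (alice_stream f x)) (bob_stream f i)).
Proof. by rewrite /run run_from_cat size_tuple. Qed.

(** Splitting over the finitely many values of [X] handles a state and a later event that read the
    same seed. *)
Lemma measurable_finite_choice {d} {T : measurableType d} {F : finType}
    (X : T -> F) (B : F -> set T) :
  (forall m, measurable [set w | X w = m]%classic) ->
  (forall m, measurable (B m)) -> measurable [set w | B (X w) w]%classic.
Proof.
move=> mX mB.
rewrite (_ : [set w | _]%classic =
    (\bigcup_(m in [set: F]) ([set w | X w = m] `&` B m))%classic).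
  by apply: fin_bigcup_measurable => // m _; exact: measurableI.
by apply/seteqP; split=> [w Bw|w [m _ [/= ->]]//]; exists (X w).
Qed.

Lemma measurable_run_from {R : realType} {U : Type} {b : nat}
    (A : streaming_algorithm R U b) t mem (s : seq U) mem' :
  measurable [set w : seed A | run_from w t mem s = mem']%classic.
Proof.
elim: s t mem => [|v s IH] t mem /=.
  have [->|/eqP neq] := eqVneq mem mem'.
    by rewrite (_ : [set _ | _]%classic = setT) //; apply/seteqP; split.
  by rewrite (_ : [set _ | _]%classic = set0) //; apply/seteqP; split.
apply: (@measurable_finite_choice _ _ _ (fun w : seed A => step w t mem v)
  (fun m => [set w | run_from w t.+1 m s = mem']%classic)) => // m.
exact: measurable_step.
Qed.

Lemma measurable_approximation {R : realType} {U : Type} {b : nat}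
    (A : streaming_algorithm R U b) (c d X : R) (s : seq U) :
  measurable [set w : seed A | is_approximation c d X (run w s)]%classic.
Proof.
have mout m : measurable
    [set w : seed A | is_approximation c d X (output w m)]%classic.
  rewrite (_ : [set w | _]%classic =
      (setT `&` (fun w : seed A => output w m) @^-1` `[X, c * X + d])%classic).
    exact: measurable_output.
  by rewrite setTI; apply/seteqP; split=> w /=; rewrite in_itv.
have mrun m0 : measurable
    [set w : seed A | is_approximation c d X (output w (run_from w 0 m0 s))]%classic.
  by apply: (measurable_finite_choice (fun w : seed A => run_from w 0 m0 s)
    _ (measurable_run_from A 0 m0 s) mout).
exact: (measurable_finite_choice (fun w : seed A => init w)
  _ (@measurable_init _ _ _ A) mrun).
Qed.

(** * From INDEX to streaming space *)

Lemma memory_lower_bound {R : realType} {k m b : nat} {c d : R} {U : finType}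
    (A : rel U -> streaming_algorithm R U b) :
  d < m.-1%:R -> (#|index_node k m| <= #|U|)%N ->
  (forall sim : rel U, symmetric sim ->
     approximates_opt_cost sim (k + m) c d (A sim)) ->
  k%:R / 20000 <= b%:R :> R.
Proof.
move=> dm leU approxA.
pose f (p : index_node k m) : U := enum_val (widen_ord leU (enum_rank p)).
have f_inj : injective f.
  by move=> p q /enum_val_inj /(congr1 val) /= /val_inj /enum_rank_inj.
have {approxA} := approxA _ (@index_sim_sym k m U f).
set Asim := A _ => approxA.
pose X x i : R := (opt_cost (induced_graph (index_sim f) (index_stream f x i)))%:R.
apply: (randomized_index_bound (seed_law Asim) k b
  (fun w x => run_from w 0 (init w) (alice_stream f x))
  (fun w mem i => d < output w (run_from w k mem (bob_stream f i)))
  (fun x i => [set w | is_approximation c d (X x i) (run w (index_stream f x i))]%classic)).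
- by move=> x i; exact: measurable_approximation.
- move=> x i w /andP[]; rewrite run_index_stream; set est := output w _ => leX Xle.
  have [xi|xi] := boolP (x i).
    rewrite (lt_le_trans _ leX) //; apply: (lt_le_trans dm).
    by rewrite ler_nat; exact: opt_cost_index_stream_true.
  apply/negbTE; rewrite -leNgt; move: Xle.
  by rewrite /X (opt_cost_index_stream_false f_inj) // mulr0 add0r.
- by move=> x i; exact/approxA/index_stream_uniq.
Qed.

(* MathComp-Analysis. [A sim] is the algorithm with access to the similarity
   function [sim], which is fixed throughout the stream. *)
Theorem theorem3 (R : realType) :
  exists (alpha : R) (n0 : nat), 0 < alpha /\
    forall (n : nat) (c d : R) (U : finType) (b : nat)
           (A : rel U -> streaming_algorithm R U b),
      (n0 <= n)%N -> 1 <= c -> 0 < d <= n%:R / 3%:R ->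
      (n ^ 2 <= #|U|)%N ->
      (forall sim : rel U, symmetric sim ->
         approximates_opt_cost sim n c d (A sim)) ->
      alpha * n%:R <= b%:R.
Proof.
(* [1 / 20000] comes from INDEX and is halved since [k >= n / 2]; [n >= 12] ensures
   [3 * (m - 1) > n]. *)
exists (1 / 20000 / 2), 12%N; split=> [|n c d U b A n12 _ /andP[_ dn] leU]; first lra.
pose m := n./2; pose k := (n - m)%N.
have m_bounds : (3 * m.-1 > n)%N /\ (m <= k)%N by rewrite /k /m; lia.
have nE : n = (k + m)%N by rewrite /k /m; lia.
clearbody m k; subst n => approxA.
apply: (@le_trans _ _ (k%:R / 20000)).
  have : m%:R <= k%:R :> R by rewrite ler_nat; lia.
  by rewrite natrD; lra.
apply: (memory_lower_bound A) approxA.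
  apply: le_lt_trans dn _.
  have : (k + m)%:R < (3 * m.-1)%:R :> R by rewrite ltr_nat; lia.
  by rewrite natrM; lra.
(* The streams draw on [k * (m + 2)] objects, at most [(k + m) ^ 2]. *)
apply: leq_trans leU; rewrite card_sum !card_prod !card_ord card_bool; nia.
Qed.
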